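(* Let $A$ be a finite alphabet with $|A| = a \ge 3$, let $n$ be a positive integer, and let $w = w_1 w_2\cdots w_N$ be a universal partial word for $A^n$. If $w_i = \diamond$, then $w_j = \diamond$ for every $j \in \{1,\dots,N\}$ with $j \equiv i \pmod n$. Equivalently, the frame of $w$ has period $n$.
   Context: A partial word over $A$ is a finite sequence of characters from $A \cup \{\diamond\}$, where $\diamond \notin A$ is a wild-card symbol; a word over $A$ contains no $\diamond$. $A^n$ denotes the set of words of length $n$ over $A$. For $x = x_1\cdots x_n \in A^n$ and a partial word $w = w_1\cdots w_N$, the position $i$ ($0 \le i \le N-n$) covers $x$ if $x_j = w_{i+j}$ for every $1\le j\le n$ with $w_{i+j}\in A$. A universal partial word for $A^n$ is a partial word $w$ such that every word in $A^n$ is covered by exactly one position of $w$. The frame of a partial word is the word over $\{\_,\diamond\}$ obtained by replacing every letter of $A$ by the symbol $\_$; a word $f$ has period $p$ if $f_i = f_j$ whenever $i\equiv j \pmod p$. *)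

(* Defs.v *)
From mathcomp Require Import all_boot.

Set Implicit Arguments.
Unset Strict Implicit.
Unset Printing Implicit Defensive.

(* [None] is the wild card, [Some c] the letter [c]. *)
Notation partial_word A := (seq (option A)).

(* Characters are numbered from 0, so [nth None w (i + j)] with [j : 'I_n] is
   the character usually written w_{i+j+1}; the first conjunct keeps every
   such index in range and says 0 <= i <= N - n without truncation. *)
Definition covers (A : finType) (n : nat) (w : partial_word A)
    (i : nat) (x : n.-tuple A) : Prop :=
  i + n <= size w /\
  forall (j : 'I_n) (c : A), nth None w (i + j) = Some c -> tnth x j = c.

Definition universal_partial_word (A : finType) (n : nat)
    (w : partial_word A) : Prop :=
  forall x : n.-tuple A, exists! i : nat, covers w i x.

Inductive frame_symbol : Type := Blank | Diamond.

Definition frame (A : finType) (w : partial_word A) : seq frame_symbol :=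
  [seq if c is Some _ then Blank else Diamond | c <- w].

Definition has_period (T : Type) (f : seq T) (p : nat) : Prop :=
  forall i j : nat, i < size f -> j < size f -> i = j %[mod p] ->
    onth f i = onth f j.

(* Main.v *)
Require Import Defs.
From mathcomp Require Import all_boot.
From mathcomp Require Import zify.

Set Implicit Arguments.
Unset Strict Implicit.

(** Let [v] be a total word of length [n - 1] occurring in [w] with a wild card
on its left and a letter [c] on its right. The wild card already accounts for
all the words [bv], so every other occurrence of [v] is a prefix of [w]. The
words [vb] with [b != c], of which there are at least two, must then all be
covered at position 0, so the prefix [v] is followed by a wild card; but then
[vc] is covered twice. Hence a wild card at [i] forces one at [i + n], and the
mirror image of the argument gives the converse. *)

(** A word is a function on [nat] of which only the values below [n] matter, so a word can be
    shifted by one place without ordinal casts. *)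
Definition fits (A : finType) (n : nat) (w : partial_word A) (i : nat)
    (f : nat -> A) : Prop :=
  i + n <= size w /\
  forall j c, j < n -> nth None w (i + j) = Some c -> f j = c.

Lemma covers_mktuple (A : finType) (n : nat) (w : partial_word A) i
    (f : nat -> A) :
  covers w i [tuple f j | j < n] <-> fits n w i f.
Proof.
split=> -[sz cov]; split=> //.
- move=> j c jn e.
  by have := cov (Ordinal jn) c e; rewrite tnth_mktuple.
- by move=> j c e; rewrite tnth_mktuple; apply: cov e.
Qed.

Lemma upw_fits_ex (A : finType) n (w : partial_word A) (f : nat -> A) :
  universal_partial_word n w -> exists i, fits n w i f.
Proof.
move=> hw; have [i [cov _]] := hw [tuple f j | j < n].
by exists i; apply/covers_mktuple.
Qed.

Lemma upw_fits_inj (A : finType) n (w : partial_word A) (f : nat -> A) i k :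
  universal_partial_word n w -> fits n w i f -> fits n w k f -> i = k.
Proof.
move=> hw /covers_mktuple ci /covers_mktuple ck.
have [m [_ um]] := hw [tuple f j | j < n].
by rewrite -(um _ ci) -(um _ ck).
Qed.

(** This is where the bound 3 enters: two different letters other than [c] make two words compete
    for one end position of [w]. *)
Lemma two_other_elements (T : finType) (c : T) : 3 <= #|T| ->
  exists b1 b2, [/\ b1 != c, b2 != c & b1 != b2].
Proof.
move=> hT; have : 1 < #|[pred x | x != c]|.
  by rewrite -ltnS (leq_trans hT) // (cardD1 c T) inE addSn add0n ltnS;
     apply/subset_leq_card/subsetP => x; rewrite !inE andbT.
by case/card_gt1P=> b1 [b2] [h1 h2 h12]; exists b1, b2; split.
Qed.

Lemma diamond_next (A : finType) n (w : partial_word A) i :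
  3 <= #|A| -> 0 < n -> universal_partial_word n w -> i + n < size w ->
  nth None w i = None -> nth None w (i + n) = None.
Proof.
move=> hA hn hw hi wi; case win: (nth None w (i + n)) => [c|] //.
have [b1 [b2 [b1c b2c b12]]] := two_other_elements c hA.
(* The window after [i] may itself contain wild cards; filling them with [c] gives a total word that
   fits there. *)
pose v j := odflt c (nth None w (i.+1 + j)).
pose g b j := if j == n.-1 then b else v j.
have at0 b : b != c -> fits n w 0 (g b).
  move=> bc; have [[|q] fq] := upw_fits_ex (g b) hw; first by [].
  have [sq cq] := fq.
  (* Shift the window from [q.+1] to [q]: drop the last letter [b] and prepend a letter that fits at
     [q]. The wild card at [i] accepts any first letter, so [h] fits at [i] too. *)
  pose h j := if j is k.+1 then v k else odflt c (nth None w q).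
  have hq : fits n w q h.
    split=> [|[|j] d jn]; first by lia.
      by rewrite addn0 /= => ->.
    rewrite addnS -addSn => /cq; rewrite /g.
    by case: eqP => [|_ /(_ (ltnW jn))]; first by lia.
  have hi' : fits n w i h.
    split=> [|[|j] d jn]; first by lia.
      by rewrite addn0 wi.
    by rewrite addnS -addSn /= /v => ->.
  (* Now [g b] sits at [i.+1], where its last letter [b] meets [c]. *)
  have qi := upw_fits_inj hw hq hi'; move: bc.
  have := cq n.-1 c; rewrite qi addSnnS prednK // leqnn /g eqxx => -> //.
  by rewrite eqxx.
have wn : nth None w n.-1 = None.
  case e: (nth None w n.-1) => [d|] //.
  have val0 b : b != c -> b = d.
    move/at0=> [_ /(_ n.-1 d)]; rewrite add0n /g eqxx prednK // leqnn.
    by apply.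
  by move: b12; rewrite (val0 _ b1c) (val0 _ b2c) eqxx.
have [s0 c0] := at0 _ b1c.
suff: 0 = i.+1 by [].
apply: (upw_fits_inj (f := g c) hw); split=> //.
- move=> j d jn e; have := c0 j d jn e; rewrite /g.
  by case: eqP => // jE; move: e; rewrite jE add0n wn.
- move=> j d jn; rewrite /g; case: eqP => [->|_].
    by rewrite addSnnS prednK // win => -[].
  by rewrite /v => ->.
Qed.

(** Mirror image of [diamond_next]: the free letter comes first, and the last position [m] replaces
    position 0. *)
Lemma diamond_prev (A : finType) n (w : partial_word A) i :
  3 <= #|A| -> 0 < n -> universal_partial_word n w -> i + n < size w ->
  nth None w (i + n) = None -> nth None w i = None.
Proof.
move=> hA hn hw hi win; case wi: (nth None w i) => [c|] //.
have [b1 [b2 [b1c b2c b12]]] := two_other_elements c hA.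
pose v j := odflt c (nth None w (i.+1 + j)).
pose g b j := if j is k.+1 then v k else b.
set m := size w - n.
have atm b : b != c -> fits n w m (g b).
  move=> bc; have [q fq] := upw_fits_ex (g b) hw.
  have [sq cq] := fq; have [<- //|qm] := eqVneq q m.
  (* Since [q] is not the last position, index [q + n] is in range, and the window can move right to
     [q.+1]. *)
  pose h j := if j == n.-1 then odflt c (nth None w (q + n)) else v j.
  have hq : fits n w q.+1 h.
    split=> [|j d jn]; first by lia.
    rewrite /h; case: eqP => [->|jE]; first by rewrite addSnnS prednK // => ->.
    by rewrite addSnnS => /cq; apply; lia.
  have hi' : fits n w i.+1 h.
    split=> [|j d jn]; first by lia.
    rewrite /h; case: eqP => [->|_]; first by rewrite addSnnS prednK // win.
    by rewrite /v => ->.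
  have [qi] := upw_fits_inj hw hq hi'; move: bc.
  by have := cq 0 c; rewrite qi addn0 /= => -> //; rewrite eqxx.
have wm : nth None w m = None.
  case e: (nth None w m) => [d|] //.
  have valm b : b != c -> b = d.
    by move/atm=> [_ /(_ 0 d)]; rewrite addn0 /=; apply.
  by move: b12; rewrite (valm _ b1c) (valm _ b2c) eqxx.
have [sm cm] := atm _ b1c.
(* Equality would give [i + n = size w], against [hi]. *)
suff: m = i by lia.
apply: (upw_fits_inj (f := g c) hw); split=> //.
- case=> [|j] d jn; first by rewrite addn0 wm.
  exact: cm.
- by lia.
- case=> [|j] d jn; first by rewrite addn0 wi => -[].
  by rewrite addnS -addSn /= /v => ->.
Qed.

Lemma diamond_addM (A : finType) n (w : partial_word A) i k :
  3 <= #|A| -> 0 < n -> universal_partial_word n w -> i + k * n < size w ->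
  nth None w i = None <-> nth None w (i + k * n) = None.
Proof.
move=> hA hn hw; elim: k => [|k IHk]; first by rewrite addn0.
rewrite mulSnr addnA => hk; have {}IHk := IHk (leq_ltn_trans (leq_addr _ _) hk).
apply: iff_trans IHk _; split; first exact: diamond_next.
exact: diamond_prev.
Qed.

Lemma eq_mod_addM n i j : i <= j -> i = j %[mod n] -> exists k, j = i + k * n.
Proof.
move=> ij /esym/eqP; rewrite eqn_mod_dvd // => /dvdnP[k e].
by exists k; rewrite -e subnKC.
Qed.

Unset Implicit Arguments.
Set Strict Implicit.

Theorem theorem4p1 (A : finType) (n : nat) (w : partial_word A)
  (hA : 3 <= #|A|) (hn : 0 < n) (hw : universal_partial_word n w) :
  (forall i j : nat, i < size w -> j < size w -> i = j %[mod n] ->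
     nth None w i = None -> nth None w j = None)
  /\ has_period (frame w) n.
Proof.
have per i j : i < size w -> j < size w -> i = j %[mod n] ->
    nth None w i = None -> nth None w j = None.
  move=> hi hj ijn; have [ij|/ltnW ji] := leqP i j.
    have [k jE] := eq_mod_addM ij ijn.
    by rewrite jE in hj *; case: (diamond_addM hA hn hw hj).
  have [k iE] := eq_mod_addM ji (esym ijn).
  by rewrite iE in hi *; case: (diamond_addM hA hn hw hi).
split=> // i j; rewrite size_map => hi hj ijn.
have onthE k : k < size w ->
    onth (frame w) k =
    Some (if nth None w k is Some _ then Blank else Diamond).
  move=> hk; rewrite /frame onthE -map_comp.
  by rewrite (nth_map None).
rewrite !onthE //.
case ei: (nth None w i) => [a|]; last by rewrite (per i j).
by case ej: (nth None w j) => [b|] //; rewrite (per j i) in ei.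
Qed.
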